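(* Let $0<\delta<1$ and $w>\sqrt{e}$, and let the number of samples $K\in\mathbb{N}$ satisfy $$K\ \geq\ \max\left\{\frac{\log(\#\mathcal{P})+\log(\delta^{-1})}{\log(w/\sqrt{e})},\ 3\right\}.$$ Then the estimators $\widetilde\Delta(\mu)$ and $\widetilde\Delta$ satisfy $$\mathbb{P}\Big\{ (\alpha_\infty w)^{-1}\widetilde\Delta(\mu)\leq \|u(\mu)-\widetilde u(\mu)\|_\Sigma\leq (\alpha_\infty w)\,\widetilde\Delta(\mu)\ \text{ for all }\mu\in\mathcal{P}\Big\}\geq 1-\delta$$ and $$\mathbb{P}\Big\{ (\alpha_2 w)^{-1}\widetilde\Delta\leq \sqrt{\tfrac{1}{\#\mathcal{P}}\sum_{\mu\in\mathcal{P}}\|u(\mu)-\widetilde u(\mu)\|_\Sigma^2}\leq (\alpha_2 w)\,\widetilde\Delta\Big\}\geq 1-\delta,$$ where $$\alpha_\infty:=\max_{\mu\in\mathcal{P}}\left(\max\left\{\frac{\Delta(\mu)}{\widetilde\Delta(\mu)},\frac{\widetilde\Delta(\mu)}{\Delta(\mu)}\right\}\right)\geq1\qquad\text{and}\qquad \alpha_2:=\max\left\{\frac{\Delta}{\widetilde\Delta},\frac{\widetilde\Delta}{\Delta}\right\}\geq 1 .$$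
   Context: Setting. $\mathcal{P}=\mathcal{P}_1\times\cdots\times\mathcal{P}_p\subset\mathbb{R}^p$ is a nonempty finite parameter set (each $\mathcal{P}_i\subset\mathbb{R}$ finite), with cardinality $\#\mathcal{P}$. For each $\mu=(\mu_1,\dots,\mu_p)\in\mathcal{P}$, $A(\mu)\in\mathbb{R}^{N\times N}$ is an invertible matrix, $f(\mu)\in\mathbb{R}^N$, and $u(\mu)\in\mathbb{R}^N$ is the solution of $A(\mu)u(\mu)=f(\mu)$. An approximation of $u$ is a given deterministic function $\widetilde u:\mathcal{P}\to\mathbb{R}^N$ of the separated form $\widetilde u(\mu)=\sum_{m=1}^M u^m_{\mathcal X}\,u^m_1(\mu_1)\cdots u^m_p(\mu_p)$ with $u^m_{\mathcal X}\in\mathbb{R}^N$ and $u^m_i:\mathcal{P}_i\to\mathbb{R}$. The residual is $r(\mu)=f(\mu)-A(\mu)\widetilde u(\mu)$. $\Sigma\in\mathbb{R}^{N\times N}$ is a symmetric positive semi-definite matrix and $\|v\|_\Sigma=\sqrt{v^T\Sigma v}$. $Z_1,\dots,Z_K$ are independent Gaussian random vectors in $\mathbb{R}^N$ with mean zero and covariance $\Sigma$ (possibly singular). $Y_i(\mu)\in\mathbb{R}^N$ denotes the solution of the random dual problem $A(\mu)^TY_i(\mu)=Z_i$, $1\leq i\leq K$, and $$\Delta(\mu)=\sqrt{\frac1K\sum_{i=1}^K\big(Y_i(\mu)^Tr(\mu)\big)^2}=\sqrt{\frac1K\sum_{i=1}^K\big(Z_i^T(u(\mu)-\widetilde u(\mu))\big)^2},\qquad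 \Delta=\sqrt{\frac{1}{\#\mathcal{P}}\sum_{\mu\in\mathcal{P}}\Delta(\mu)^2}.$$ The matrix $Y(\mu)=[Y_1(\mu),\dots,Y_K(\mu)]\in\mathbb{R}^{N\times K}$ is approximated by a matrix of separated form $\widetilde Y(\mu)=\sum_{m=1}^L Y^m_{\mathcal X}\,Y^m_1(\mu_1)\cdots Y^m_p(\mu_p)$ with $Y^m_{\mathcal X}\in\mathbb{R}^{N\times K}$ and $Y^m_i:\mathcal{P}_i\to\mathbb{R}$, computed from $Z_1,\dots,Z_K$ (so it is random and may depend on $Z_1,\dots,Z_K$; its entries are random variables). No accuracy of this approximation is assumed. $\widetilde Y_i(\mu)$ denotes the $i$-th column of $\widetilde Y(\mu)$. The fast-to-evaluate estimators are $$\widetilde\Delta(\mu)=\sqrt{\frac1K\sum_{i=1}^K\big(\widetilde Y_i(\mu)^Tr(\mu)\big)^2},\qquad \widetilde\Delta=\sqrt{\frac{1}{\#\mathcal{P}}\sum_{\mu\in\mathcal{P}}\widetilde\Delta(\mu)^2}.$$ The numbers $\alpha_\infty$ and $\alpha_2$ are random (they depend on $Z_1,\dots,Z_K$); it is assumed that almost surely the denominators in their definitions are nonzero. $\log$ is the natural logarithm and $e=\exp(1)$. *)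

(* Defs.v *)
From mathcomp Require Import all_boot all_order all_algebra finmap.
From mathcomp Require Import all_classical all_reals all_analysis.

Set Implicit Arguments.
Unset Strict Implicit.
Unset Printing Implicit Defensive.

Import Order.TTheory GRing.Theory Num.Theory.
Import numFieldNormedType.Exports.

Local Open Scope classical_set_scope.
Local Open Scope ring_scope.

(* The grid P_1 x ... x P_p: mu assigns to each i an element mu i of P_i. *)
Definition grid (R : realType) (p : nat) (Pi : 'I_p -> {fset R}) : finType :=
  {dffun forall i : 'I_p, Pi i}.

(* v mu = \sum_m F_1^m(mu_1) ... F_p^m(mu_p) X^m, with n terms. *)
Definition separated_form (R : realType) (p : nat) (Pi : 'I_p -> {fset R})
    (V : lmodType R) (n : nat) (v : grid Pi -> V) : Prop :=
  exists (X : 'I_n -> V) (F : 'I_n -> forall i : 'I_p, Pi i -> R),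
    forall mu : grid Pi,
      v mu = \sum_(m < n) (\prod_(i < p) F m i (mu i)) *: X m.

Definition sympsd (R : realType) (N : nat) (Sigma : 'M[R]_N) : Prop :=
  Sigma^T = Sigma /\ forall v : 'cV[R]_N, 0 <= (v^T *m Sigma *m v) 0 0.

Definition mxnorm (R : realType) (N : nat) (Sigma : 'M[R]_N) (v : 'cV[R]_N) : R :=
  Num.sqrt ((v^T *m Sigma *m v) 0 0).

Definition rms (R : realType) (I : finType) (g : I -> R) : R :=
  Num.sqrt (#|I|%:R^-1 * \sum_(i : I) g i ^+ 2).

(* Random vectors take values in N.-tuple R, which carries the product (Borel)
   sigma-algebra; colvec turns such a value into a matrix column. *)
Definition colvec (R : realType) (N : nat) (z : N.-tuple R) : 'cV[R]_N :=
  \col_(j < N) tnth z j.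

(* N(m, s^2). [normal_prob m 0] is a default value (a uniform law), so the
   degenerate Gaussian has to be given separately. *)
Definition gaussian_law (R : realType) (m s : R) (B : set R) : \bar R :=
  if s == 0 then \d_m B else normal_prob m s B.

Definition gaussian_vector (d : measure_display) (T : measurableType d)
    (R : realType) (P : probability T R) (N : nat)
    (Z : {RV P >-> N.-tuple R}) : Prop :=
  forall a : 'cV[R]_N, exists m s : R, forall B : set R, measurable B ->
    P ((fun t => (a^T *m colvec (Z t)) 0 0) @^-1` B) = gaussian_law m s B.

Definition mean_zero (d : measure_display) (T : measurableType d)
    (R : realType) (P : probability T R) (N : nat)
    (Z : {RV P >-> N.-tuple R}) : Prop :=
  forall j : 'I_N, ('E_P[fun t => tnth (Z t) j] = 0)%E.

Definition has_covariance (d : measure_display) (T : measurableType d)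
    (R : realType) (P : probability T R) (N : nat)
    (Z : {RV P >-> N.-tuple R}) (Sigma : 'M[R]_N) : Prop :=
  forall j k : 'I_N,
    covariance P (fun t => tnth (Z t) j) (fun t => tnth (Z t) k)
    = (Sigma j k)%:E.

Definition independent_vectors (d : measure_display) (T : measurableType d)
    (R : realType) (P : probability T R) (N K : nat)
    (Z : 'I_K -> {RV P >-> N.-tuple R}) : Prop :=
  forall (J : {set 'I_K}) (B : 'I_K -> set (N.-tuple R)),
    (forall i, measurable (B i)) ->
    P (\bigcap_(i in [set` J]) (Z i @^-1` B i))
    = (\prod_(i in J) P (Z i @^-1` B i))%E.

(* sqrt (1/K \sum_i (Y_i^T r)^2), with Y_i the i-th column of Y. *)
Definition estimator (R : realType) (N K : nat)
    (Y : 'M[R]_(N, K)) (r : 'cV[R]_N) : R :=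
  rms (fun i : 'I_K => ((col i Y)^T *m r) 0 0).

Definition max_ratio (R : realType) (x y : R) : R := Num.max (x / y) (y / x).

(* The maximum over I of the max_ratio's; these are nonnegative when D and D'
   are, so that the default value 0 plays no role on a nonempty I. *)
Definition max_ratios (R : realType) (I : finType) (D D' : I -> R) : R :=
  \big[Num.max/0]_(i : I) max_ratio (D i) (D' i).

(* Main.v *)
From HB Require Import structures.
Require Import Defs.
From mathcomp Require Import all_boot all_order all_algebra finmap.
From mathcomp Require Import all_classical all_reals all_analysis.
From mathcomp Require Import measurable_realfun.
From mathcomp Require Import ring lra.

Set Implicit Arguments.
Unset Strict Implicit.
Unset Printing Implicit Defensive.

Import Order.TTheory GRing.Theory Num.Theory.
Import numFieldNormedType.Exports.

Local Open Scope classical_set_scope.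
Local Open Scope ring_scope.

(* For fixed mu, put e = u mu - ut mu. Duality gives Y_i^T r = Z_i^T e, so the
   K numbers Z_i^T e are independent centred Gaussians of variance
   sigma^2 = ||e||_Sigma^2, and K Delta(mu)^2 / sigma^2 is chi-square with K
   degrees of freedom. Chernoff's bound with E exp(- l g^2) =
   (1 + 2 l sigma^2)^(-1/2), taken at 1 + 2 l sigma^2 = w^2 and w^-2, bounds the
   lower and the upper tail by (w^-1 e^((1 - w^-2) / 2))^K and
   (w e^(- (w^2 - 1) / 2))^K; for w^2 >= e and K >= 3 these add up to at most
   (sqrt e / w)^K. A union bound over the grid gives, with probability at least
   1 - delta, Delta(mu) / w <= ||e||_Sigma <= w Delta(mu) for all mu, and hence
   the same for the root mean squares. Finally Delta and Deltat differ at most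
   by the factor alpha. *)

(** * Numerical tail estimates *)

Lemma expR_ge_exp_series (R : realType) (x : R) (n : nat) :
  0 <= x -> \sum_(0 <= i < n) x ^+ i / i`!%:R <= expR x.
Proof.
move=> x0; apply: (nondecreasing_cvgn_le (u_ := series (exp_coeff x))).
  apply: nondecreasing_series => i _ _; exact: exp_coeff_ge0.
exact: is_cvg_series_exp_coeff.
Qed.

Lemma expR_ge_quadratic (R : realType) (x : R) :
  0 <= x -> 1 + x + x ^+ 2 / 2 <= expR x.
Proof.
move=> x0; apply: le_trans (expR_ge_exp_series 3 x0).
by rewrite !big_nat_recr//= big_geq// add0r !factS fact0 expr0 expr1 !divr1.
Qed.

(** The first four terms of the series already give [1 + 1 + 1/2 + 1/6 = 8/3]. *)
Lemma expR1_ge83 (R : realType) : 8 / 3 <= expR (1 : R).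
Proof.
apply: le_trans (expR_ge_exp_series 4 ler01).
rewrite !big_nat_recr//= big_geq// add0r !expr1n !divr1 !div1r !factS fact0 /=.
by rewrite !natrM; lra.
Qed.

(* With x = 3 / (2 s) <= 9 / 16, the first term is at most
   1 / (1 + x + x^2 / 2) <= 1 - 2 x / 3 = 1 - 1 / s, and the second one is at
   most 1 / s because s <= e * (3 s / 8) <= expR (3 s / 8). *)
Lemma chi2_tail_numeric (R : realType) (s : R) : expR 1 <= s ->
  expR (- (2 * s)^-1) ^+ 3 + (s * expR (- (s / 2))) ^+ 3 <= 1.
Proof.
move=> es; have s83 : 8 / 3 <= s by exact: le_trans (expR1_ge83 R) es.
have s0 : 0 < s by lra.
have sle : s <= expR (3 / 8 * s).
  have -> : 3 / 8 * s = 1 + (3 / 8 * s - 1) by lra.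
  rewrite expRD.
  have h1 : 3 / 8 * s <= expR (3 / 8 * s - 1).
    by apply: le_trans (expR_ge1Dx _); lra.
  have := ler_pM (_ : 0 <= 8 / 3) (_ : 0 <= 3 / 8 * s) (expR1_ge83 R) h1.
  have -> : 8 / 3 * (3 / 8 * s) = s by lra.
  by apply; lra.
(* Multiplied out, this is [s ^+ 4 <= expR (3 / 2 * s)], the fourth power of [sle]. *)
have t2 : (s * expR (- (s / 2))) ^+ 3 <= s^-1.
  rewrite exprMn -expRM_natl -[leRHS]mul1r ler_pdivlMr// mulrAC -exprSr.
  have -> : 3%:R * - (s / 2) = - (4%:R * (3 / 8 * s)) by lra.
  by rewrite expRN ler_pdivrMr ?expR_gt0// mul1r expRM_natl lerXn2r// nnegrE
    ?ltW ?expR_gt0.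
pose x := 3 / 2 * s^-1.
have sV : s^-1 <= 3 / 8 by rewrite -[leRHS]invf_div lef_pV2 ?posrE//; lra.
have sV0 : 0 < s^-1 by rewrite invr_gt0.
have x0 : 0 <= x by rewrite /x; lra.
have x1 : x <= 9 / 16 by rewrite /x; lra.
have t1 : expR (- (2 * s)^-1) ^+ 3 <= 1 - s^-1.
  have -> : 1 - s^-1 = 1 - 2 / 3 * x by rewrite /x; lra.
  rewrite -expRM_natl (_ : 3%:R * _ = - x); last first.
    by rewrite /x invfM; lra.
  rewrite expRN -[leLHS]mul1r ler_pdivrMr ?expR_gt0//.
  apply: (@le_trans _ _ ((1 - 2 / 3 * x) * (1 + x + x ^+ 2 / 2))); last first.
    by rewrite ler_wpM2l ?expR_ge_quadratic//; lra.
  (* The product expands to [1 + x/3 - x^2/6 - x^3/3], which is at least 1 because [2 - x - 2 x^2]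
     is positive for [0 <= x <= 9/16]. *)
  by nra.
lra.
Qed.

(** Put [s = w^2 >= e]. Dividing the two bases by [sqrt e / w] leaves [b = s e^(-s/2)] and
    [a = e^(-1/(2s))], and [a^3 + b^3 <= 1] by [chi2_tail_numeric]. Hence neither exceeds 1, and
    raising the exponent from 3 to [K] only decreases the sum. *)
Lemma chi2_tails_le (R : realType) (w : R) (K : nat) : (3 <= K)%N ->
  Num.sqrt (expR 1) < w ->
  (w * expR (- ((w ^+ 2 - 1) / 2))) ^+ K
  + (w^-1 * expR ((1 - (w ^+ 2)^-1) / 2)) ^+ K
  <= (Num.sqrt (expR 1) / w) ^+ K.
Proof.
move=> K3 hw.
have sq : Num.sqrt (expR 1) = expR (2^-1) :> R.
  rewrite -[X in expR X](_ : 2^-1 *+ 2 = 1); last by lra.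
  by rewrite mulr2n expRD -expr2 sqrtr_sqr ger0_norm// expR_ge0.
rewrite sq in hw *.
have w0 : 0 < w by apply: lt_trans hw; rewrite expR_gt0.
have es : expR 1 <= w ^+ 2.
  rewrite [X in expR X](_ : 1 = 2%:R * 2^-1); last by lra.
  by rewrite expRM_natl lerXn2r ?nnegrE ?expR_ge0 1?ltW.
set s := w ^+ 2 in es *.
set a := expR (- (2 * s)^-1); set b := s * expR (- (s / 2)).
have s0 : 0 < s by rewrite exprn_gt0.
have -> : w * expR (- ((s - 1) / 2)) = expR 2^-1 / w * b.
  rewrite /b /s; have -> : - ((w ^+ 2 - 1) / 2) = 2^-1 + - (w ^+ 2 / 2) by lra.
  by rewrite expRD; field; rewrite gt_eqF.
have -> : w^-1 * expR ((1 - s^-1) / 2) = expR 2^-1 / w * a.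
  rewrite /a; have -> : (1 - s^-1) / 2 = 2^-1 + - (2 * s)^-1.
    by rewrite (invfM 2 s); lra.
  by rewrite expRD; ring.
rewrite [in leLHS]exprMn [X in _ + X]exprMn -mulrDr -[leRHS]mulr1 ler_wpM2l//.
  by rewrite exprn_ge0// divr_ge0 ?expR_ge0 ?ltW.
have num := chi2_tail_numeric es.
have a0 : 0 <= a by exact: expR_ge0.
have b0 : 0 <= b by rewrite mulr_ge0 ?expR_ge0 ?ltW.
have le1 (c : R) : 0 <= c -> c ^+ 3 <= 1 -> c ^+ K <= c ^+ 3.
  move=> c0 c3; apply: ler_wiXn2l => //.
  by rewrite -(@expr_le1 _ 3).
apply: (le_trans _ num); rewrite addrC; apply: lerD; apply: le1 => //.
  by apply: (le_trans _ num); rewrite lerDl exprn_ge0.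
by apply: (le_trans _ num); rewrite lerDr exprn_ge0.
Qed.

(** * Densities and products of independent variables *)

Section ge0_integral_density.
Local Open Scope ereal_scope.
Import HBNNSimple.
Variables (d d' : measure_display) (T : measurableType d)
  (T' : measurableType d') (R : realType).
Variables (mu : {measure set T -> \bar R}) (nu : {measure set T' -> \bar R}).
Variables (X : T -> T') (h : T -> R).
Hypothesis mX : measurable_fun [set: T] X.
Hypothesis mh : measurable_fun [set: T] h.
Hypothesis h0 : forall x, (0 <= h x)%R.
Hypothesis nuE : forall B, measurable B ->
  nu B = \int[mu]_(x in X @^-1` B) (h x)%:E.

Let mpreimX (B : set T') : measurable B -> measurable (X @^-1` B).
Proof. by move=> mB; rewrite -[X in measurable X]setTI; exact: mX. Qed.

Let integral_density_nnsfun (s : {nnsfun T' >-> R}) :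
  \int[nu]_y (s y)%:E = \int[mu]_x ((h x)%:E * (s (X x))%:E).
Proof.
have ms r : measurable (X @^-1` (s @^-1` [set r])) by exact: mpreimX.
rewrite integralT_nnsfun sintegralE.
under [RHS]eq_integral => x _.
  rewrite fimfunE -fsumEFin// ge0_mule_fsumr; last first.
    by move=> r; rewrite EFinM nnfun_muleindic_ge0.
  over.
have mhi r : measurable_fun [set: T]
    (fun x => (h x)%:E * (\1_(s @^-1` [set r]) (X x))%:E).
  apply: emeasurable_funM; first exact/measurable_EFinP.
  apply/measurable_EFinP; apply: measurableT_comp mX.
  exact: measurable_indic.
rewrite [RHS]ge0_integral_fsum//; last 2 first.
- move=> r; under eq_fun do rewrite EFinM muleCA.
  exact: measurable_funeM.
- move=> r x _; rewrite mule_ge0 ?lee_fin//.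
  by rewrite -lee_fin EFinM nnfun_muleindic_ge0.
(* A value [r] of the simple function has the form [s y], so it is nonnegative and may be pulled out
   of the integral. *)
apply: eq_fsbigr => r /[!inE] -[y _ <-{r}].
under [RHS]eq_integral do rewrite EFinM muleCA.
rewrite ge0_integralZl_EFin//; last by move=> x _; rewrite mule_ge0// lee_fin.
by rewrite nuE// integral_mkcond epatch_indic.
Qed.

(** Here [nu] is the image under [X] of the measure with density [h] with respect to [mu]; the
    formula passes from simple functions to [g] by monotone convergence. Taking [X = id] gives
    integration against a density, and [h = 1] gives integration against the law of [X]. *)
Lemma ge0_integral_density (g : T' -> \bar R) :
  measurable_fun [set: T'] g -> (forall y, 0 <= g y) ->
  \int[nu]_y g y = \int[mu]_x ((h x)%:E * g (X x)).
Proof.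
move=> mg g0; pose g_ := nnsfun_approx measurableT mg.
transitivity (limn (fun n => \int[nu]_y (g_ n y)%:E)).
  rewrite -monotone_convergence//.
  - apply: eq_integral => y _; apply/esym/cvg_lim => //.
    by apply: cvg_nnsfun_approx.
  - by move=> n; exact/measurable_EFinP/measurable_funP.
  - by move=> n y _; rewrite lee_fin.
  - by move=> y _ m n mn; rewrite lee_fin; exact/lefP/nd_nnsfun_approx.
rewrite [X in limn X](_ : _ =
    (fun n => \int[mu]_x ((h x)%:E * (g_ n (X x))%:E))); last first.
  by apply/funext => n; exact: integral_density_nnsfun.
rewrite -monotone_convergence//.
- apply: eq_integral => x _; apply/cvg_lim => //.
  by apply: cvgeZl => //; exact: cvg_nnsfun_approx.
- move=> n; apply: emeasurable_funM; apply/measurable_EFinP => //.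
  exact: measurableT_comp.
- by move=> n y _; rewrite mule_ge0// lee_fin.
- move=> y _ m n mn; rewrite lee_wpmul2l ?lee_fin//.
  exact/lefP/nd_nnsfun_approx.
Qed.

End ge0_integral_density.

(** Only the product over all indices is required: choosing [B i] to be the full set for some [i]
    recovers the product rule for subfamilies. *)
Definition mutually_independent (d : measure_display) (T : measurableType d)
    (R : realType) (P : probability T R) (I : finType)
    (X : I -> {RV P >-> R}) : Prop :=
  forall B : I -> set R, (forall i, measurable (B i)) ->
    P (\bigcap_i (X i @^-1` B i)) = (\prod_i P (X i @^-1` B i))%E.

Lemma indic_bigcap (R : comPzRingType) (T : Type) (I : finType)
    (A : I -> set T) (x : T) :
  \1_(\bigcap_i A i) x = \prod_i \1_(A i) x :> R.
Proof.
rewrite indicE; case: (boolP (_ \in _)); rewrite ?inE ?notin_setE => xA.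
  by rewrite big1// => i _; rewrite indicE mem_set//; exact: xA.
have [i nAi] : exists i, ~ A i x.
  apply: contrapT => h; apply: xA => i _; apply: contrapT => nAi.
  by apply: h; exists i.
by rewrite (bigD1 i)//= indicE memNset ?mul0r.
Qed.

Section expectation_prod.
Local Open Scope ereal_scope.
Variables (d : measure_display) (T : measurableType d) (R : realType)
  (P : probability T R) (K : nat) (X : 'I_K -> {RV P >-> R}).
Hypothesis indX : mutually_independent X.

(* Replace the indicators by arbitrary functions one coordinate at a time. *)
Let expectation_prod_rec (k : nat) (g : 'I_K -> R -> R) (e : 'I_K -> R) :
  (forall i : 'I_K, (k <= i)%N -> exists2 B, measurable B & g i = \1_B) ->
  (forall i, measurable_fun [set: R] (g i)) ->
  (forall i x, (0 <= g i x)%R) ->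
  (forall i, \int[P]_t (g i (X i t))%:E = (e i)%:E) ->
  \int[P]_t (\prod_i g i (X i t))%:E = (\prod_i e i)%:E.
Proof.
elim: k g e => [|k ih] g e gB mg g0 gE.
  have {}gB i := cid2 (gB i isT).
  pose B i := s2val (gB i).
  have gBE i : g i = \1_(B i) by exact: (s2valP' (gB i)).
  have mB i : measurable (X i @^-1` B i).
    by apply: measurable_funPTI; exact: (s2valP (gB i)).
  transitivity (\int[P]_t (\1_(\bigcap_i (X i @^-1` B i)) t)%:E).
    apply: eq_integral => t _; rewrite indic_bigcap; congr (_%:E).
    by apply: eq_bigr => i _; rewrite gBE !indicE.
  rewrite integral_indic//; last exact: fin_bigcap_measurable.
  rewrite setIT; apply: etrans (indX (B := B) _) _.
    by move=> i; exact: (s2valP (gB i)).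
  rewrite -prodEFin; apply: eq_bigr => i _.
  rewrite -gE -[X in P X]setIT -integral_indic//.
  by apply: eq_integral => t _; rewrite gBE !indicE.
have [kK|Kk] := ltnP k K; last first.
  by apply: ih => // i ki; have := leq_trans Kk ki; rewrite leqNgt ltn_ord.
pose i0 := Ordinal kK.
pose W t := (\prod_(i | i != i0) g i (X i t))%R.
have W0 t : (0 <= W t)%R by apply: prodr_ge0.
have e0 i : (0 <= e i)%R.
  by rewrite -lee_fin -gE integral_ge0// => t _; rewrite lee_fin.
have c0 : (0 <= \prod_(i | i != i0) e i)%R by apply: prodr_ge0.
have mW : measurable_fun [set: T] W.
  rewrite /W; under eq_fun do rewrite big_mkcond/=.
  apply: measurable_prod => i _; case: (i != i0) => //.
  exact: measurableT_comp.
(* With [g i0] replaced by the indicator of [B], the induction hypothesis says that weighting [P] by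
   the product [W] of the other factors merely rescales the law of [X i0]. [ge0_integral_density]
   then replaces the indicator by [g i0]. *)
have nuE B : measurable B ->
    mscale (NngNum c0) (distribution P (X i0)) B =
    \int[P]_(t in X i0 @^-1` B) (W t)%:E.
  move=> mB; have mXB : measurable (X i0 @^-1` B) by exact: measurable_funPTI.
  pose g' i := if i == i0 then \1_B : R -> R else g i.
  pose e' i := if i == i0 then fine (P (X i0 @^-1` B)) else e i.
  have : \int[P]_t (\prod_i g' i (X i t))%:E = (\prod_i e' i)%:E.
    apply: ih => [i ki|i|i x|i]; rewrite /g' /e'.
    - case: eqVneq => [_|ii0]; first by exists B.
      by apply: gB; rewrite ltn_neqAle ki andbT eq_sym.
    - by case: eqVneq.
    - by case: eqVneq => // _; rewrite indicE.
    - case: eqVneq => // ->; rewrite fineK ?fin_num_measure// -[X in P X]setIT.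
      by rewrite -integral_indic//; apply: eq_integral => t _; rewrite !indicE.
  rewrite (bigD1 i0)//= {1}/e' eqxx.
  under eq_integral do rewrite (bigD1 i0)//= {1}/g' eqxx.
  rewrite /mscale/= EFinM fineK ?fin_num_measure// muleC.
  rewrite (eq_bigr e); last by move=> i /negbTE ii0; rewrite /e' ii0.
  move=> <-; rewrite [RHS]integral_mkcond epatch_indic.
  apply: eq_integral => t _ /=; rewrite muleC -EFinM.
  congr ((_ * _)%:E).
  by apply: eq_bigr => i /negbTE ii0; rewrite /g' ii0.
have mgE : measurable_fun [set: R] (EFin \o g i0) by exact/measurable_EFinP.
have gE0 y : 0 <= (EFin \o g i0) y by rewrite lee_fin.
have := @ge0_integral_density _ _ _ _ _ P _ (X i0) W _ mW W0 nuE _ mgE gE0.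
rewrite ge0_integral_mscale// ge0_integral_distribution//= gE -EFinM => h.
rewrite (bigD1 i0)//= mulrC h//.
by apply: eq_integral => t _; rewrite (bigD1 i0)//= mulrC EFinM.
Qed.

Lemma expectation_prod_indep (g : 'I_K -> R -> R) (e : 'I_K -> R) :
  (forall i, measurable_fun [set: R] (g i)) ->
  (forall i x, (0 <= g i x)%R) ->
  (forall i, \int[P]_t (g i (X i t))%:E = (e i)%:E) ->
  \int[P]_t (\prod_i g i (X i t))%:E = (\prod_i e i)%:E.
Proof.
by apply: (@expectation_prod_rec K) => i; rewrite leqNgt ltn_ord.
Qed.

End expectation_prod.

(** * Laplace transform and moments of Gaussian laws *)

(** Completing the square: a normal density times a Gaussian weight is a constant times the normal
    density of variance [s^2 / v]. The sign of [l] is free as long as [v] stays positive; the upper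
    tail uses a negative [l]. *)
Lemma normal_pdfM_expR (R : realType) (m s l c x : R) :
  s != 0 -> 0 < 1 + 2 * l * s ^+ 2 ->
  let v := 1 + 2 * l * s ^+ 2 in
  normal_pdf m s x * expR (- (l * (x - c) ^+ 2)) =
  (Num.sqrt v)^-1 * expR (- (l * (m - c) ^+ 2 / v)) *
  normal_pdf ((m + 2 * l * s ^+ 2 * c) / v) (s / Num.sqrt v) x.
Proof.
move=> s0 v0 v; have vneq0 : v != 0 by rewrite gt_eqF.
have q0 : Num.sqrt v != 0 by rewrite gt_eqF// sqrtr_gt0.
have s'0 : s / Num.sqrt v != 0 by rewrite mulf_neq0// invr_eq0.
have qq : Num.sqrt v ^+ 2 = v by rewrite sqr_sqrtr// ltW.
rewrite !normal_pdfE// /normal_peak /normal_fun !exprMn exprVn qq.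
have -> : s ^+ 2 * v^-1 * pi *+ 2 = (s ^+ 2 * pi *+ 2) / v.
  by ring.
rewrite sqrtrM; last by rewrite mulrn_wge0// mulr_ge0 ?sqr_ge0 ?pi_ge0.
rewrite sqrtrV ?(ltW v0)//.
have expE : expR (- (x - m) ^+ 2 / (s ^+ 2 *+ 2)) * expR (- (l * (x - c) ^+ 2))
  = expR (- (l * (m - c) ^+ 2 / v)) *
    expR (- (x - (m + 2 * l * s ^+ 2 * c) / v) ^+ 2 / (s ^+ 2 / v *+ 2)).
  rewrite -!expRD; congr expR.
  rewrite /v in vneq0 *; field.
  by rewrite s0 vneq0.
have S0 : Num.sqrt (s ^+ 2 * pi *+ 2) != 0.
  rewrite gt_eqF// sqrtr_gt0 pmulrn_lgt0// mulr_gt0 ?pi_gt0//.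
  by rewrite exprn_even_gt0.
rewrite -[LHS]mulrA {}expE; move: S0 q0.
set S := Num.sqrt _; set q := Num.sqrt v => S0 q0.
set E1 := expR _; set E2 := expR _; clearbody S q E1 E2.
by field; rewrite q0 S0.
Qed.

Section gaussian_law_expR.
Local Open Scope ereal_scope.
Variable R : realType.
Implicit Types m s l c : R.

Lemma ge0_integral_normal_prob m s (g : R -> \bar R) :
  measurable_fun [set: R] g -> (forall x, 0 <= g x) ->
  \int[normal_prob m s]_x g x =
  \int[lebesgue_measure]_x ((normal_pdf m s x)%:E * g x).
Proof.
move=> mg g0; apply: (ge0_integral_density (X := id)) => //.
  exact: measurable_normal_pdf.
by move=> x; exact: normal_pdf_ge0.
Qed.

Lemma measurable_expR_quadratic l c :
  measurable_fun [set: R] (fun x => expR (- (l * (x - c) ^+ 2))).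
Proof.
apply: measurableT_comp => //; apply: measurable_funN.
by apply: measurable_funM => //; apply: measurable_funX; exact: measurable_funB.
Qed.

Lemma integral_normal_prob_expR m s l c :
  s != 0%R -> (0 < 1 + 2 * l * s ^+ 2)%R ->
  \int[normal_prob m s]_x (expR (- (l * (x - c) ^+ 2)))%:E =
  ((Num.sqrt (1 + 2 * l * s ^+ 2))^-1 *
   expR (- (l * (m - c) ^+ 2 / (1 + 2 * l * s ^+ 2))))%:E.
Proof.
move=> s0 v0; rewrite ge0_integral_normal_prob; last 2 first.
- by apply/measurable_EFinP; exact: measurable_expR_quadratic.
- by move=> x; rewrite lee_fin expR_ge0.
under eq_integral do rewrite -EFinM normal_pdfM_expR// EFinM.
rewrite ge0_integralZl_EFin//.
- by rewrite integral_normal_pdf mule1.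
- by move=> x _; rewrite lee_fin normal_pdf_ge0.
- by apply/measurable_EFinP; exact: measurable_normal_pdf.
Qed.

Variables (d : measure_display) (T : measurableType d) (P : probability T R).

(** The formula also covers the Dirac law: at [s = 0] it reads [exp (- l (m - c)^2)]. The centre [c]
    is kept free because varying it later identifies [m]. *)
Lemma expectation_gaussian_law_expR (X : {RV P >-> R}) m s l c :
  (forall B, measurable B -> P (X @^-1` B) = gaussian_law m s B) ->
  (0 < 1 + 2 * l * s ^+ 2)%R ->
  \int[P]_t (expR (- (l * (X t - c) ^+ 2)))%:E =
  ((Num.sqrt (1 + 2 * l * s ^+ 2))^-1 *
   expR (- (l * (m - c) ^+ 2 / (1 + 2 * l * s ^+ 2))))%:E.
Proof.
move=> XE v0; pose g x := (expR (- (l * (x - c) ^+ 2)))%:E.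
have mg : measurable_fun [set: measurableTypeR R] g.
  by apply/measurable_EFinP; exact: measurable_expR_quadratic.
have g0 x : 0 <= g x by rewrite lee_fin expR_ge0.
(* normal_prob is a measure on measurableTypeR R, which carries the same
   sigma-algebra as R but under another display. *)
have mX : measurable_fun [set: T] (X : T -> measurableTypeR R).
  by move=> _ B mB; exact: (@measurable_funPT _ _ _ _ X measurableT B mB).
have transfer (nu : {measure set (measurableTypeR R) -> \bar R}) :
    (forall B, measurable B -> nu B = P (X @^-1` B)) ->
    \int[P]_t g (X t) = \int[nu]_x g x.
  move=> nuE; rewrite (ge0_integral_density (h := cst 1%R) (mu := P) mX)//.
    by apply: eq_integral => t _; rewrite mul1e.
  move=> B mB; have mXB : measurable (X @^-1` B).
    by rewrite -[X in measurable X]setTI; exact: mX.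
  rewrite -[RHS]/(\int[P]_(t in X @^-1` B) cst 1 t) integral_cst// mul1e.
  exact: nuE.
have [s0|s0] := eqVneq s 0%R.
  rewrite (transfer (\d_(m : measurableTypeR R))); last first.
    by move=> B mB; rewrite XE// /gaussian_law s0 eqxx.
  rewrite integral_dirac// diracT mul1e /g s0 expr0n/= mulr0 addr0 sqrtr1.
  by rewrite invr1 mul1r mulr1.
rewrite (transfer (normal_prob m s)); last first.
  by move=> B mB; rewrite XE// /gaussian_law (negbTE s0).
exact: integral_normal_prob_expR.
Qed.

End gaussian_law_expR.

(** Squeeze with [x / (1 + x) <= 1 - exp (- x) <= x] at [x = y n / (n + 1)]. The argument [y] may
    vary with [n], as it does through [d / v n] in the Laplace transform below. *)
Lemma cvg_scaled_onem_expR (R : realType) (y : R^nat) (l : R) :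
  (forall n, 0 <= y n) -> y @ \oo --> l ->
  n.+1%:R * (1 - expR (- (n.+1%:R^-1 * y n))) @[n --> \oo] --> l.
Proof.
move=> y0 yl; apply: (@squeeze_cvgr _ _ _ _
    (fun n => y n * (1 + n.+1%:R^-1 * y n)^-1) y) => //; last first.
  have := cvg_harmonic (R := R); rewrite /harmonic => h.
  rewrite -[l in X in _ --> X]mulr1 -[X in _ * X]invr1 -[X in X^-1]addr0.
  rewrite -(mul0r l); apply: cvgM => //; apply: cvgV.
    by rewrite mul0r addr0 oner_eq0.
  by apply: cvgD; [exact: cvg_cst|exact: cvgM].
apply: nearW => n /=; set x := n.+1%:R^-1 * y n.
have x0 : 0 <= x by rewrite mulr_ge0.
have n0 : 0 < n.+1%:R :> R by [].
have -> : y n = n.+1%:R * x by rewrite mulrA divff ?mul1r// gt_eqF.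
rewrite -mulrA !(ler_pM2l n0); apply/andP; split.
  rewrite ler_pdivrMr ?ltr_wpDr// expRN.
  have : (expR x)^-1 * (1 + x) <= 1.
    by rewrite mulrC ler_pdivrMr ?expR_gt0// mul1r expR_ge1Dx.
  by rewrite mulrBl mul1r; lra.
have := expR_ge1Dx (- x); lra.
Qed.

Lemma cvg_gaussian_laplace (R : realType) (s d : R) : 0 <= d ->
  let v n : R := 1 + 2 * n.+1%:R^-1 * s ^+ 2 in
  let q n := Num.sqrt (v n) in
  n.+1%:R * (1 - (q n)^-1)
  + (q n)^-1 * (n.+1%:R * (1 - expR (- (n.+1%:R^-1 * (d / v n)))))
    @[n --> \oo] --> s ^+ 2 + d.
Proof.
move=> d0 v q.
have v0 n : 0 < v n by rewrite ltr_wpDr// mulr_ge0 ?sqr_ge0// mulr_ge0.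
have q0 n : 0 < q n by rewrite sqrtr_gt0.
have h0 : n.+1%:R^-1 @[n --> \oo] --> (0 : R) by exact: cvg_harmonic.
have vl : v n @[n --> \oo] --> (1 : R).
  rewrite -[X in _ --> X]addr0 -(mul0r (s ^+ 2)) -(mulr0 2).
  apply: cvgD; first exact: cvg_cst.
  by apply: cvgM; [apply: cvgM => //; exact: cvg_cst|exact: cvg_cst].
have ql : q n @[n --> \oo] --> (1 : R).
  rewrite -sqrtr1; apply: continuous_cvg => //; exact: sqrt_continuous.
apply: cvgD.
  (* Since [(n + 1) (q^2 - 1) = 2 s^2] exactly, multiplying by the conjugate [q + 1] removes the
     indeterminate form. *)
  have -> : (fun n => n.+1%:R * (1 - (q n)^-1)) =
      (fun n => 2 * s ^+ 2 / (q n * (q n + 1))).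
    apply/funext => n; have := q0 n.
    have : q n ^+ 2 = v n by rewrite sqr_sqrtr// ltW.
    rewrite /v; move: (q n) => r rr r0.
    have <- : n.+1%:R * (r ^+ 2 - 1) = 2 * s ^+ 2.
      by rewrite rr addrAC subrr add0r; field.
    by field; rewrite !gt_eqF ?addr_gt0.
  rewrite [X in _ --> X](_ : _ = 2 * s ^+ 2 / (1 * (1 + 1))); last by field.
  apply: cvgM; first exact: cvg_cst.
  apply: cvgV; first by rewrite mul1r.
  by apply: cvgM => //; apply: cvgD => //; exact: cvg_cst.
rewrite -[X in _ --> X]mul1r -[X in X * _]invr1; apply: cvgM.
  by apply: cvgV.
apply: cvg_scaled_onem_expR => [n|].
  by rewrite divr_ge0// ltW.
rewrite -[X in _ --> X]mulr1 -[X in _ * X]invr1.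
by apply: cvgM; [exact: cvg_cst|apply: cvgV].
Qed.

Section gaussian_law_moments.
Local Open Scope ereal_scope.
Variables (R : realType) (d : measure_display) (T : measurableType d)
  (P : probability T R) (X : {RV P >-> R}) (m s : R).
Let Pcst (r : R) : \int[P]_t (cst r t)%:E = r%:E.
Proof. by have := expectation_cst P r; rewrite unlock. Qed.

Hypothesis XE : forall B, measurable B -> P (X @^-1` B) = gaussian_law m s B.

(* Obtained as the limit, as l tends to 0, of (1 - E[exp(- l (X - c)^2)]) / l. *)
Lemma gaussian_law_second_moment (c : R) :
  P.-integrable [set: T] (fun t => ((X t - c) ^+ 2)%:E) ->
  \int[P]_t ((X t - c) ^+ 2)%:E = (s ^+ 2 + (m - c) ^+ 2)%:E.
Proof.
move=> iX.
pose f n t : \bar R :=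
  (n.+1%:R * (1 - expR (- (n.+1%:R^-1 * (X t - c) ^+ 2))))%:E.
have mE n : measurable_fun [set: T]
    (fun t => expR (- (n.+1%:R^-1 * (X t - c) ^+ 2))).
  exact: (measurableT_comp (measurable_expR_quadratic _ _)).
have mf n : measurable_fun [set: T] (f n).
  apply/measurable_EFinP; apply: measurable_funM => //.
  exact: measurable_funB.
have ff t : [set: T] t -> f ^~ t @ \oo --> ((X t - c) ^+ 2)%:E.
  move=> _; apply: cvg_EFin; first exact: nearW.
  apply: (@cvg_scaled_onem_expR R (fun=> (X t - c) ^+ 2)%R).
    by move=> _; exact: sqr_ge0.
  exact: cvg_cst.
(* The limit itself dominates the sequence, again by [1 - exp (- x) <= x]. *)
have fX t n : [set: T] t -> `|f n t| <= ((X t - c) ^+ 2)%:E.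
  move=> _; rewrite /f abse_EFin lee_fin.
  set y := ((X t - c) ^+ 2)%R; have y0 : (0 <= y)%R by exact: sqr_ge0.
  have i0 : (0 <= n.+1%:R^-1 * y)%R by rewrite mulr_ge0.
  rewrite ger0_norm; last first.
    by rewrite mulr_ge0// subr_ge0 expR_le1 oppr_le0.
  by rewrite -ler_pdivlMl// lerBlDr -lerBlDl; exact: expR_ge1Dx.
have [_ _] := @dominated_convergence _ _ _ P _ measurableT f
  (fun t => ((X t - c) ^+ 2)%:E) (fun t => ((X t - c) ^+ 2)%:E) mf
  (measurable_int _ iX) (aeW _ ff) iX (aeW _ fX).
move=> cvgX; apply: (cvg_unique (@ereal_hausdorff R) cvgX) => /=.
pose v n := (1 + 2 * n.+1%:R^-1 * s ^+ 2)%R.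
have v1 n : (1 <= v n)%R by rewrite lerDl mulr_ge0 ?sqr_ge0// mulr_ge0.
have v0 n : (0 < v n)%R by rewrite (lt_le_trans _ (v1 n)).
pose q n := Num.sqrt (v n).
have q0 n : (0 < q n)%R by rewrite sqrtr_gt0.
have iE n : P.-integrable [set: T]
    (EFin \o (fun t => expR (- (n.+1%:R^-1 * (X t - c) ^+ 2)))).
  apply: (@le_integrable _ _ _ P _ measurableT _ (EFin \o cst 1%R)).
  - exact/measurable_EFinP.
  - move=> t _ /=; rewrite lee_fin normr1 ger0_norm ?expR_ge0// expR_le1.
    by rewrite oppr_le0 mulr_ge0 ?sqr_ge0.
  - exact: finite_measure_integrable_cst.
(* With [E] the exponential, [1 - E / q] is split as [(1 - 1/q) + (1 - E) / q], the form whose limit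
   [cvg_gaussian_laplace] computes. *)
pose a n := (n.+1%:R * (1 - (q n)^-1) + (q n)^-1 * (n.+1%:R *
    (1 - expR (- (n.+1%:R^-1 * ((m - c) ^+ 2 / v n))))))%R.
have fE : (fun n => \int[P]_t f n t) = EFin \o a.
  apply/funext => n; rewrite /f /a /=; under eq_integral do rewrite EFinM EFinB.
  rewrite integralZl//; last first.
    apply: (integrableB measurableT _ (iE n)).
    exact: finite_measure_integrable_cst.
  rewrite integralB_EFin//; last exact: finite_measure_integrable_cst.
  rewrite (expectation_gaussian_law_expR c XE); last exact: v0.
  rewrite -/(v n) -/(q n) (Pcst 1) -EFinB -EFinM.
  rewrite -[(_ * (m - c) ^+ 2 / v n)%R]mulrA; congr (_%:E).
  by move: (expR _) => E; ring.
rewrite [X in X @ _ --> _]fE; apply: cvg_EFin; first exact: nearW.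
by apply: cvg_gaussian_laplace; exact: sqr_ge0.
Qed.

(** The second moments about 0 and about 1 give [s^2 + m^2 = sigma2] and
    [s^2 + (m - 1)^2 = sigma2 + 1]; subtracting them forces [m = 0]. *)
Lemma gaussian_law_centered (sigma2 : R) :
  P.-integrable [set: T] (fun t => (X t)%:E) ->
  P.-integrable [set: T] (fun t => (X t ^+ 2)%:E) ->
  \int[P]_t (X t)%:E = 0 -> \int[P]_t (X t ^+ 2)%:E = sigma2%:E ->
  m = 0%R /\ (s ^+ 2)%R = sigma2.
Proof.
move=> iX iX2 EX EX2.
have i1 : P.-integrable [set: T] (fun t => (X t ^+ 2 - 2 * X t)%:E).
  under eq_fun do rewrite EFinB (EFinM 2%R).
  by apply: integrableB => //; exact: integrableZl.
have iX1 : P.-integrable [set: T] (fun t => ((X t - 1) ^+ 2)%:E).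
  have := integrableD measurableT i1
    (finite_measure_integrable_cst P 1 measurableT).
  by apply: eq_integrable => // t _ /=; rewrite -EFinD; congr (_%:E); ring.
have := @gaussian_law_second_moment 0.
under eq_fun do rewrite subr0.
rewrite EX2 subr0 => /(_ iX2)[e0].
have := gaussian_law_second_moment iX1.
have -> : \int[P]_t ((X t - 1) ^+ 2)%:E = (sigma2 + 1)%:E.
  transitivity (\int[P]_t ((X t ^+ 2 - 2 * X t)%:E + (cst 1%R t)%:E)).
    by apply: eq_integral => t _; rewrite -EFinD; congr (_%:E) => /=; ring.
  rewrite integralD//; last exact: finite_measure_integrable_cst.
  rewrite Pcst EFinD; congr (_ + _).
  transitivity (\int[P]_t ((X t ^+ 2)%:E - 2%:E * (X t)%:E)).
    by apply: eq_integral => t _; rewrite -EFinM -EFinB.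
  rewrite integralB//; last exact: integrableZl.
  by rewrite integralZl// EX EX2 mule0 sube0.
move=> [e1].
have m0 : m = 0%R by nra.
by split => //; move: e0; rewrite m0; lra.
Qed.

End gaussian_law_moments.

(** * Moments of linear forms of a random vector *)

Section linear_functional_moments.
Local Open Scope ereal_scope.
Variables (R : realType) (d : measure_display) (T : measurableType d)
  (P : probability T R) (N : nat) (Z : {RV P >-> N.-tuple R})
  (Sigma : 'M[R]_N) (a : 'cV[R]_N).
Hypotheses (Z0 : mean_zero Z) (ZSigma : has_covariance Z Sigma).

Let z (j : 'I_N) (t : T) : R := tnth (Z t) j.

Let mz j : measurable_fun [set: T] (z j).
Proof. exact: (measurableT_comp (@measurable_tnth _ R N j)). Qed.

Let expectation_zM j k : \int[P]_t (z j t * z k t)%:E = (Sigma j k)%:E.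
Proof.
rewrite -ZSigma unlock Z0 Z0 unlock; apply: eq_integral => t _ /=.
by rewrite -[RHS]/(((z j t - 0) * (z k t - 0))%R%:E) !subr0.
Qed.

(** Integrability comes from the covariance: the integral of the nonnegative [z j ^+ 2] is the real
    number [Sigma j j]. Products and first powers follow by [|x y| <= x^2 + y^2] and
    [|x| <= x^2 + 1]. *)
Let integrable_z2 j : P.-integrable [set: T] (fun t => (z j t ^+ 2)%:E).
Proof.
apply/integrableP; split.
  by apply/measurable_EFinP; exact: measurable_funX.
under eq_integral do rewrite abse_EFin ger0_norm ?sqr_ge0// expr2.
by rewrite expectation_zM ltry.
Qed.

Let integrable_zM j k : P.-integrable [set: T] (fun t => (z j t * z k t)%:E).
Proof.
apply: (le_integrable measurableT _ _
  (integrableD measurableT (integrable_z2 j) (integrable_z2 k))).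
  by apply/measurable_EFinP; exact: measurable_funM.
move=> t _ /=; rewrite lee_fin normrM.
rewrite [leRHS]ger0_norm ?addr_ge0 ?sqr_ge0// -(real_normK (num_real (z j t))).
rewrite -(real_normK (num_real (z k t))).
have := sqr_ge0 (`|z j t| - `|z k t|)%R; have := normr_ge0 (z j t).
have := normr_ge0 (z k t); nra.
Qed.

Let integrable_z j : P.-integrable [set: T] (fun t => (z j t)%:E).
Proof.
apply: (le_integrable measurableT _ _ (integrableD measurableT (integrable_z2 j)
   (finite_measure_integrable_cst P 1%R measurableT))).
  exact/measurable_EFinP.
move=> t _ /=; rewrite lee_fin.
rewrite [leRHS]ger0_norm ?addr_ge0 ?sqr_ge0// -(real_normK (num_real (z j t))).
have := sqr_ge0 (`|z j t| - 1)%R; have := normr_ge0 (z j t); nra.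
Qed.

Let XE t : (a^T *m colvec (Z t)) 0%R 0%R = (\sum_j a j 0 * z j t)%R.
Proof. by rewrite mxE; apply: eq_bigr => j _; rewrite !mxE. Qed.

Let X2E t : ((a^T *m colvec (Z t)) 0%R 0%R ^+ 2 =
  \sum_j \sum_k a j 0 * a k 0 * (z j t * z k t))%R.
Proof.
rewrite XE expr2 mulr_suml; apply: eq_bigr => j _; rewrite mulr_sumr.
by apply: eq_bigr => k _; ring.
Qed.

Lemma integrable_linear_functional :
  P.-integrable [set: T] (fun t => ((a^T *m colvec (Z t)) 0%R 0%R)%:E).
Proof.
under eq_fun do rewrite XE -sumEFin.
apply: integrable_sum => //= j _; under eq_fun do rewrite EFinM.
exact: integrableZl.
Qed.

Lemma expectation_linear_functional :
  \int[P]_t ((a^T *m colvec (Z t)) 0%R 0%R)%:E = 0.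
Proof.
under eq_integral do rewrite XE -sumEFin.
rewrite integral_sum//=; last first.
  by move=> j; under eq_fun do rewrite EFinM; exact: integrableZl.
rewrite big1// => j _; under eq_integral do rewrite EFinM.
by rewrite integralZl//; have := Z0 j; rewrite unlock => ->; rewrite mule0.
Qed.

Let integrable_aazz j k :
  P.-integrable [set: T] (fun t => (a j 0 * a k 0 * (z j t * z k t))%:E).
Proof. by under eq_fun do rewrite EFinM; exact: integrableZl. Qed.

Let integrable_aazz_sum j : P.-integrable [set: T]
  (fun t => (\sum_k a j 0 * a k 0 * (z j t * z k t))%:E)%R.
Proof.
by under eq_fun do rewrite -sumEFin; apply: integrable_sum => //= k _.
Qed.

Lemma integrable_linear_functional_sqr :
  P.-integrable [set: T] (fun t => ((a^T *m colvec (Z t)) 0%R 0%R ^+ 2)%:E).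
Proof.
under eq_fun do rewrite X2E -sumEFin.
by apply: integrable_sum => //= j _.
Qed.

Lemma expectation_linear_functional_sqr :
  \int[P]_t ((a^T *m colvec (Z t)) 0%R 0%R ^+ 2)%:E =
  ((a^T *m Sigma *m a) 0%R 0%R)%:E.
Proof.
under eq_integral do rewrite X2E -sumEFin.
rewrite integral_sum//= mxE -sumEFin.
under [RHS]eq_bigr do rewrite mxE mulr_suml -sumEFin.
rewrite [RHS]exchange_big/=; apply: eq_bigr => j _.
under eq_integral do rewrite -sumEFin.
rewrite integral_sum//=; apply: eq_bigr => k _.
under eq_integral do rewrite EFinM.
rewrite integralZl// expectation_zM -EFinM mxE; congr (_%:E).
by ring.
Qed.

End linear_functional_moments.

(** * Concentration of the root mean square of independent Gaussians *)

(** Markov's inequality: [f] dominates the indicator of [A]. *)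
Lemma le_measure_integral (d : measure_display) (T : measurableType d)
    (R : realType) (mu : {measure set T -> \bar R}) (A : set T) (f : T -> R) :
  measurable A -> measurable_fun [set: T] f -> (forall t, 0 <= f t) ->
  (forall t, A t -> 1 <= f t) -> (mu A <= \int[mu]_t (f t)%:E)%E.
Proof.
move=> mA mf f0 f1; rewrite -[A in leLHS]setIT -integral_indic//.
apply: ge0_le_integral => //.
- by apply/measurable_EFinP; exact: measurable_indic.
- exact/measurable_EFinP.
- move=> t _; rewrite lee_fin indicE; case: (boolP (t \in A)) => //=.
  by rewrite inE; exact: f1.
Qed.

Lemma measurable_rms (d : measure_display) (T : measurableType d)
    (R : realType) (I : finType) (f : I -> T -> R) :
  (forall i, measurable_fun [set: T] (f i)) ->
  measurable_fun [set: T] (fun t => rms (f ^~ t)).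
Proof.
move=> mf; apply: (@measurableT_comp _ _ _ _ _ _ (@Num.sqrt R)).
  by apply: continuous_measurable_fun; exact: sqrt_continuous.
apply: measurable_funM => //; apply: measurable_sum => i.
exact: measurable_funX.
Qed.

Lemma measure_fin_subadditive (d : measure_display) (T : measurableType d)
    (R : realType) (mu : {measure set T -> \bar R}) (I : finType)
    (A : I -> set T) (B : set T) :
  (forall i, measurable (A i)) -> measurable B -> B `<=` \bigcup_i A i ->
  (mu B <= \sum_i mu (A i))%E.
Proof.
move=> mA mB BA; pose U s := \big[setU/set0]_(i <- s) A i.
have mU s : measurable (U s) by apply: bigsetU_measurable.
apply: (@le_trans _ _ (mu (U (index_enum I)))).
  apply: le_measure; rewrite ?inE//; move=> t /BA[i _ Ait].
  by rewrite /U -bigcup_seq; exists i => //=; exact: mem_index_enum.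
elim: (index_enum I) => [|i s ih]; first by rewrite /U !big_nil measure0.
rewrite [U _]big_cons big_cons; apply: le_trans (measureU2 mu (mA i) (mU s)) _.
exact: leeD.
Qed.

Section gaussian_rms_concentration.
Variables (R : realType) (d : measure_display) (T : measurableType d)
  (P : probability T R) (K : nat) (X : 'I_K -> {RV P >-> R}).
Variables (sigma2 : R) (s : 'I_K -> R).
Hypothesis indX : mutually_independent X.
Hypothesis XE : forall i B, measurable B ->
  P (X i @^-1` B) = gaussian_law 0 (s i) B.
Hypothesis sE : forall i, s i ^+ 2 = sigma2.

Let S t : R := \sum_i X i t ^+ 2.

Let mS : measurable_fun [set: T] S.
Proof. by apply: measurable_sum => i; exact: measurable_funX. Qed.

Let expectation_expR_sum_sqr (l : R) : 0 < 1 + 2 * l * sigma2 ->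
  (\int[P]_t (expR (- (l * S t)))%:E
   = ((Num.sqrt (1 + 2 * l * sigma2))^-1 ^+ K)%:E)%E.
Proof.
move=> v0; under eq_integral do rewrite /S mulr_sumr -sumrN expR_sum.
rewrite (expectation_prod_indep indX (g := fun _ x => expR (- (l * x ^+ 2)))
  (e := fun=> (Num.sqrt (1 + 2 * l * sigma2))^-1)).
- by rewrite prodr_const card_ord.
- move=> _; have := @measurable_expR_quadratic R l 0.
  by under eq_fun do rewrite subr0.
- by move=> _ x; exact: expR_ge0.
- move=> i; have := @expectation_gaussian_law_expR _ _ _ _ _ _ _ l 0 (XE i).
  under eq_integral do rewrite subr0.
  by rewrite subr0 sE => -> //; rewrite expr0n/= mulr0 mul0r oppr0 expR0 mulr1.
Qed.

(** Stated for [l * S t] so as to serve both tails: a positive [l] bounds the lower tail of [S], a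
    negative one the upper tail. *)
Let chernoff_sum_sqr (l b : R) : 0 < 1 + 2 * l * sigma2 ->
  (P [set t | (l * S t <= b)%R]
   <= (expR b * (Num.sqrt (1 + 2 * l * sigma2))^-1 ^+ K)%:E)%E.
Proof.
move=> v0.
have mlS : measurable_fun [set: T] (fun t => l * S t) by exact: measurable_funM.
have mE : measurable_fun [set: T] (fun t => expR (- (l * S t))).
  by apply: measurableT_comp => //; exact: measurable_funN.
rewrite EFinM -expectation_expR_sum_sqr//.
rewrite -ge0_integralZl_EFin//; last exact/measurable_EFinP.
under eq_integral do rewrite -EFinM.
apply: le_measure_integral.
- rewrite -[X in measurable X]setTI.
  by apply: measurable_fun_ler.
- exact: measurable_funM.
- by move=> t; rewrite mulr_ge0 ?expR_ge0.
- by move=> t /= h; rewrite -expRD -expR0 ler_expR subr_ge0.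
Qed.

Variable w : R.
Hypotheses (K3 : (3 <= K)%N) (hw : Num.sqrt (expR 1) < w).

Let w1 : 1 < w.
Proof.
apply: le_lt_trans hw; rewrite -[leLHS]sqrtr1 ler_wsqrtr// -[leLHS]expR0.
by rewrite ler_expR.
Qed.

Let w0 : 0 < w. Proof. exact: lt_trans w1. Qed.

Let gaussian_tails : 0 < sigma2 ->
  (P [set t | (K%:R * (w ^+ 2 * sigma2) <= S t)%R]
   + P [set t | (S t <= K%:R * (sigma2 / w ^+ 2))%R]
   <= ((Num.sqrt (expR 1) / w) ^+ K)%:E)%E.
Proof.
move=> s0; have := chi2_tails_le K3 hw; rewrite -lee_fin; apply: le_trans.
have sn0 : sigma2 != 0 by rewrite gt_eqF.
have wn0 : w != 0 by rewrite gt_eqF.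
have ww1 : 1 < w ^+ 2 by rewrite exprn_egt1.
have wV1 : (w ^+ 2)^-1 < 1 by rewrite invf_lt1// exprn_gt0.
rewrite EFinD; apply: leeD.
(* Upper tail: this [l] minimises the Chernoff bound [exp (l K w^2 sigma2) (1 + 2 l sigma2)^(-K/2)].
   Being negative, it reverses the inequality defining the event. *)
- pose l := - ((1 - (w ^+ 2)^-1) / (2 * sigma2)).
  have vE : 1 + 2 * l * sigma2 = (w ^+ 2)^-1.
    by rewrite /l; field; rewrite ?sn0 ?wn0.
  have l0 : l < 0 by rewrite /l oppr_lt0 divr_gt0 ?subr_gt0 ?mulr_gt0.
  have -> : [set t | K%:R * (w ^+ 2 * sigma2) <= S t] =
      [set t | l * S t <= l * (K%:R * (w ^+ 2 * sigma2))].
    by apply/seteqP; split => t /=; rewrite ler_nM2l.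
  have := @chernoff_sum_sqr l (l * (K%:R * (w ^+ 2 * sigma2))).
  rewrite vE invr_gt0 exprn_gt0// => /(_ isT).
  rewrite (sqrtrV (sqr_ge0 w)) sqrtr_sqr (gtr0_norm w0) invrK.
  have -> : l * (K%:R * (w ^+ 2 * sigma2)) = K%:R * - ((w ^+ 2 - 1) / 2).
    by rewrite /l; field; rewrite ?sn0 ?wn0.
  by rewrite expRM_natl -exprMn [X in (X ^+ _)%:E]mulrC.
(* Lower tail: again the minimiser, now for the threshold [K sigma2 / w^2]. *)
- pose l := (w ^+ 2 - 1) / (2 * sigma2).
  have vE : 1 + 2 * l * sigma2 = w ^+ 2 by rewrite /l; field; rewrite ?sn0 ?wn0.
  have l0 : 0 < l by rewrite divr_gt0 ?subr_gt0 ?mulr_gt0.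
  have -> : [set t | S t <= K%:R * (sigma2 / w ^+ 2)] =
      [set t | l * S t <= l * (K%:R * (sigma2 / w ^+ 2))].
    by apply/seteqP; split => t /=; rewrite ler_pM2l.
  have := @chernoff_sum_sqr l (l * (K%:R * (sigma2 / w ^+ 2))).
  rewrite vE exprn_gt0// => /(_ isT).
  rewrite sqrtr_sqr (gtr0_norm w0).
  have -> : l * (K%:R * (sigma2 / w ^+ 2)) = K%:R * ((1 - (w ^+ 2)^-1) / 2).
    by rewrite /l; field; rewrite ?sn0 ?wn0.
  by rewrite expRM_natl -exprMn [X in (X ^+ _)%:E]mulrC.
Qed.

Let mrmsX : measurable_fun [set: T] (fun t => rms (fun i => X i t)).
Proof. by apply: measurable_rms => i. Qed.

Let measurable_bad : measurable
  [set t | ~~ (w^-1 * rms (fun i => X i t) <= Num.sqrt sigma2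
               <= w * rms (fun i => X i t))].
Proof.
rewrite (_ : [set _ | _] =
  (fun t => (w^-1 * rms (fun i => X i t) <= Num.sqrt sigma2) &&
  (Num.sqrt sigma2 <= w * rms (fun i => X i t))) @^-1` [set false]); last first.
  by apply/seteqP; split => t /=; [move=> /negbTE|move=> ->].
rewrite -[X in measurable X]setTI; suff: measurable_fun [set: T]
  (fun t => (w^-1 * rms (fun i => X i t) <= Num.sqrt sigma2) &&
  (Num.sqrt sigma2 <= w * rms (fun i => X i t))) by apply.
by apply: measurable_and; apply: measurable_fun_ler => //;
  exact: measurable_funM.
Qed.

Let rms_sqr t : K%:R * rms (fun i => X i t) ^+ 2 = S t.
Proof.
rewrite sqr_sqrtr; last by rewrite mulr_ge0// sumr_ge0// => i _; exact: sqr_ge0.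
by rewrite card_ord mulrA divff ?mul1r// pnatr_eq0 -lt0n (leq_trans _ K3).
Qed.

Lemma gaussian_rms_concentration :
  (P [set t | ~~ (w^-1 * rms (fun i => X i t) <= Num.sqrt sigma2
                  <= w * rms (fun i => X i t))%R]
   <= ((Num.sqrt (expR 1) / w) ^+ K)%:E)%E.
Proof.
have K0 : 0 < K%:R :> R by rewrite ltr0n (leq_trans _ K3).
have := @measurable_bad.
(* [K3] unfolds to [2 < K], so [Ordinal K3] is the index 2 of ['I_K]. *)
have : 0 <= sigma2 by rewrite -(sE (Ordinal K3)) sqr_ge0.
rewrite le_eqVlt => /predU1P[s0|s0].
  move=> mB.
  pose A i := X i @^-1` (~` [set 0]).
  have X0 i : P (A i) = 0%E.
    rewrite /A XE; last exact: measurableC.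
    have := sE i; rewrite -s0 => /eqP; rewrite sqrf_eq0 => /eqP ->.
    by rewrite /gaussian_law eqxx diracE memNset//=; apply.
  have mX0 i : measurable (A i).
    by apply: measurable_funPTI; exact: measurableC.
  apply: (@le_trans _ _ 0%E); last first.
    by rewrite lee_fin exprn_ge0// divr_ge0 ?sqrtr_ge0 ?ltW.
  rewrite (_ : 0 = \sum_i P (A i))%E; last by rewrite big1.
  apply: measure_fin_subadditive => //.
  move=> t /= bad; apply: contrapT => X0t; move: bad => /negP; apply.
  have -> : rms (fun i => X i t) = 0.
    rewrite /rms big1 ?mulr0 ?sqrtr0// => i _.
    have -> : X i t = 0 by apply: contrapT => Xit; apply: X0t; exists i.
    by rewrite expr0n.
  by rewrite -s0 !mulr0 sqrtr0 lexx.
have mlo : measurable [set t | K%:R * (w ^+ 2 * sigma2) <= S t].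
  by rewrite -[X in measurable X]setTI; exact: measurable_fun_ler.
have mhi : measurable [set t | S t <= K%:R * (sigma2 / w ^+ 2)].
  by rewrite -[X in measurable X]setTI; exact: measurable_fun_ler.
move=> mB; apply: (le_trans _ (gaussian_tails s0)).
apply: (le_trans _ (measureU2 P mlo mhi)); apply: le_measure; rewrite ?inE//.
  exact: measurableU.
(* Failure of the left inequality puts [S] in the upper tail, failure of the right one puts it in
   the lower tail. *)
move=> t /=; rewrite negb_and -!ltNge => /orP[].
  rewrite ltr_pdivlMl// => h; left; rewrite -rms_sqr ler_pM2l//.
  rewrite -[X in _ * X](sqr_sqrtr (ltW s0)) -exprMn.
  by rewrite lerXn2r ?ltW// nnegrE ?mulr_ge0 ?sqrtr_ge0 ?ltW.
move=> h; right; rewrite -rms_sqr ler_pM2l// ler_pdivlMr ?exprn_gt0//.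
rewrite -exprMn -[leRHS](sqr_sqrtr (ltW s0)) mulrC.
by rewrite lerXn2r ?ltW// nnegrE ?mulr_ge0 ?sqrtr_ge0 ?ltW.
Qed.

End gaussian_rms_concentration.

(** * Measurability and deterministic comparison *)

(** Writes [1 / x] as [x * (x^2)^(-1)]: the base of the real power is then nonnegative, where [powR]
    agrees with the inverse. At [x = 0] both sides are 0 by the convention [0^-1 = 0]. *)
Lemma measurable_invr (d : measure_display) (T : measurableType d)
    (R : realType) (f : T -> R) :
  measurable_fun [set: T] f -> measurable_fun [set: T] (fun t => (f t)^-1).
Proof.
move=> mf; rewrite (_ : (fun _ => _) = fun t => f t * (f t ^+ 2) `^ (-1)).
  apply: measurable_funM => //.
  apply: (@measurableT_comp _ _ _ _ _ _ (@powR R ^~ (-1))) => //.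
  exact: measurable_funX.
apply/funext => t; rewrite powR_inv1 ?sqr_ge0//.
have [->|f0] := eqVneq (f t) 0; first by rewrite invr0 mul0r.
by rewrite expr2 invfM mulVKf.
Qed.

Lemma measurable_max_ratio (d : measure_display) (T : measurableType d)
    (R : realType) (f g : T -> R) :
  measurable_fun [set: T] f -> measurable_fun [set: T] g ->
  measurable_fun [set: T] (fun t => max_ratio (f t) (g t)).
Proof.
by move=> mf mg; apply: measurable_maxr; apply: measurable_funM => //;
  exact: measurable_invr.
Qed.

Lemma measurable_max_ratios (d : measure_display) (T : measurableType d)
    (R : realType) (I : finType) (f g : T -> I -> R) :
  (forall i, measurable_fun [set: T] (f ^~ i)) ->
  (forall i, measurable_fun [set: T] (g ^~ i)) ->
  measurable_fun [set: T] (fun t => max_ratios (f t) (g t)).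
Proof.
move=> mf mg; rewrite /max_ratios; elim: (index_enum I) => [|i s ih].
  by under eq_fun do rewrite big_nil; exact: measurable_cst.
under eq_fun do rewrite big_cons.
by apply: measurable_maxr => //; exact: measurable_max_ratio.
Qed.

Lemma measurable_le_le (d : measure_display) (T : measurableType d)
    (R : realType) (f g h : T -> R) :
  measurable_fun [set: T] f -> measurable_fun [set: T] g ->
  measurable_fun [set: T] h -> measurable [set t | f t <= g t <= h t].
Proof.
move=> mf mg mh; rewrite -[X in measurable X]setTI.
apply: (@measurable_and _ _ _ (fun t => f t <= g t) (fun t => g t <= h t)) => //;
  exact: measurable_fun_ler.
Qed.

Section max_ratio_theory.
Variable R : realType.
Implicit Types (x y e w : R) (I : finType).

Lemma ler_max_ratiol x y : 0 < y -> x <= max_ratio x y * y.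
Proof.
by move=> y0; rewrite -ler_pdivrMr// le_max lexx.
Qed.

Lemma ler_max_ratior x y : 0 < x -> y <= max_ratio x y * x.
Proof.
by move=> x0; rewrite -ler_pdivrMr// le_max lexx orbT.
Qed.

Lemma max_ratio_ge1 x y : 0 < x -> 0 < y -> 1 <= max_ratio x y.
Proof.
move=> x0 y0; rewrite le_max ler_pdivlMr// mul1r ler_pdivlMr// mul1r.
exact: le_total.
Qed.

Lemma le_max_ratios I (D D' : I -> R) i :
  max_ratio (D i) (D' i) <= max_ratios D D'.
Proof. exact: le_bigmax_cond. Qed.

(** Applied with [x] the exact estimator, [y] its fast approximation and [a] a bound on their ratio
    both ways. *)
Lemma le_le_transfer (a w x y e : R) : 0 < a -> 0 < w ->
  x <= a * y -> y <= a * x -> w^-1 * x <= e <= w * x ->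
  (a * w)^-1 * y <= e <= (a * w) * y.
Proof.
move=> a0 w0 xy yx /andP[xe ex]; apply/andP; split.
  apply: le_trans xe; rewrite invfM mulrAC mulrC ler_pM2l ?invr_gt0//.
  by rewrite ler_pdivrMl.
by apply: le_trans ex _; rewrite [a * w]mulrC -mulrA ler_pM2l.
Qed.

Lemma rms_ge0 I (g : I -> R) : 0 <= rms g.
Proof. exact: sqrtr_ge0. Qed.

Lemma rms_le I (f g : I -> R) (c : R) : 0 <= c ->
  (forall i, 0 <= f i <= c * g i) -> rms f <= c * rms g.
Proof.
move=> c0 fg; rewrite -[c in leRHS](ger0_norm c0) -sqrtr_sqr -sqrtrM ?sqr_ge0//.
rewrite ler_wsqrtr// mulrCA ler_wpM2l ?invr_ge0// mulr_sumr.
apply: ler_sum => i _; have /andP[f0 fcg] := fg i.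
by rewrite -exprMn lerXn2r// nnegrE// (le_trans f0).
Qed.

End max_ratio_theory.

(** Since [sqrt e < w], the denominator [ln (w / sqrt e)] is positive; clearing it and
    exponentiating turns the condition on [K] into [n / delta <= (w / sqrt e)^K]. *)
Lemma sample_size_bound (R : realType) (n K : nat) (delta w : R) :
  (0 < n)%N -> 0 < delta -> Num.sqrt (expR 1) < w ->
  (ln n%:R + ln delta^-1) / ln (w / Num.sqrt (expR 1)) <= K%:R ->
  n%:R * (Num.sqrt (expR 1) / w) ^+ K <= delta.
Proof.
move=> n0 d0 hw; set q := Num.sqrt (expR 1).
have q0 : 0 < q by rewrite sqrtr_gt0 expR_gt0.
have w0 : 0 < w by exact: lt_trans hw.
have wq : 1 < w / q by rewrite ltr_pdivlMr// mul1r.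
have wq0 : 0 < w / q by exact: lt_trans wq.
have n0' : 0 < n%:R :> R by rewrite ltr0n.
rewrite ler_pdivrMr ?ln_gt0// -lnM ?posrE ?invr_gt0//.
rewrite [leRHS]mulr_natl -lnXn// ler_ln ?posrE ?exprn_gt0 ?divr_gt0//.
rewrite ler_pdivrMr// => h; rewrite -invf_div exprVn ler_pdivrMr ?exprn_gt0//.
by rewrite mulrC.
Qed.

Lemma estimator_dual (R : realType) (N K : nat) (A : 'M[R]_N)
    (f u ut : 'cV[R]_N) (Y : 'M[R]_(N, K)) (z : 'I_K -> N.-tuple R) :
  A *m u = f -> (forall i, A^T *m col i Y = colvec (z i)) ->
  estimator Y (f - A *m ut) =
  rms (fun i => ((u - ut)^T *m colvec (z i)) 0 0).
Proof.
move=> <- Yz; rewrite /estimator -mulmxBr; congr rms; apply/funext => i.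
(* The entry is that of a 1 x 1 matrix, so transposing moves [A^T] off the dual solution and onto
   the error as [A]. *)
rewrite -Yz (_ : (u - ut)^T *m _ = ((col i Y)^T *m (A *m (u - ut)))^T).
  by rewrite [RHS]mxE.
by rewrite !trmx_mul trmxK mulmxA.
Qed.

(** * Concentration of the dual estimator *)

Section linear_form.
Variables (R : realType) (d : measure_display) (T : measurableType d)
  (P : probability T R) (N : nat).

(** A named function of [z], so that it can be declared measurable and composed with a random
    vector. *)
Definition linear_form (a : 'cV[R]_N) (z : N.-tuple R) : R :=
  (a^T *m colvec z) 0 0.

Lemma measurable_linear_form (a : 'cV[R]_N) :
  measurable_fun [set: N.-tuple R] (linear_form a).
Proof.
rewrite (_ : linear_form a = fun z => \sum_j a j 0 * tnth z j).
  by apply: measurable_sum => j; apply: measurable_funM => //;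
    exact: measurable_tnth.
apply/funext => z; rewrite /linear_form mxE.
by apply: eq_bigr => j _; rewrite !mxE.
Qed.

HB.instance Definition _ (a : 'cV[R]_N) := isMeasurableFun.Build _ _ _ _
  (linear_form a) (measurable_linear_form a).

Definition linear_form_RV (a : 'cV[R]_N) (Z : {RV P >-> N.-tuple R}) :
  {RV P >-> R} := linear_form a \o Z.

Lemma independent_linear_forms (K : nat) (Z : 'I_K -> {RV P >-> N.-tuple R})
    (a : 'cV[R]_N) :
  independent_vectors Z ->
  mutually_independent (fun i => linear_form_RV a (Z i)).
Proof.
move=> indZ B mB.
have mB' i : measurable (linear_form a @^-1` B i).
  by rewrite -[X in measurable X]setTI; exact: measurable_linear_form.
have := indZ [set: 'I_K]%SET _ mB'.
rewrite (_ : \bigcap_(i in _) _ =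
    \bigcap_i (linear_form_RV a (Z i) @^-1` B i)); last first.
  by apply/seteqP; split => t h i _; apply: h => //=; rewrite inE.
by move=> ->; apply: eq_bigl => i; rewrite inE.
Qed.

(** [gaussian_vector] leaves the parameters of the law unspecified; the first two moments of the
    linear form, computed from the mean and the covariance, identify them. The sign of [s] stays
    undetermined. *)
Lemma gaussian_vector_linear_form (Z : {RV P >-> N.-tuple R}) (Sigma : 'M[R]_N)
    (a : 'cV[R]_N) :
  gaussian_vector Z -> mean_zero Z -> has_covariance Z Sigma ->
  exists2 s : R, s ^+ 2 = (a^T *m Sigma *m a) 0 0 &
    forall B, measurable B ->
      P (linear_form_RV a Z @^-1` B) = gaussian_law 0 s B.
Proof.
move=> gZ Z0 ZS; have [m [s ms]] := gZ a.
have [m0 s2] := @gaussian_law_centered _ _ _ _ (linear_form_RV a Z) m s ms _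
  (integrable_linear_functional a Z0 ZS)
  (integrable_linear_functional_sqr a Z0 ZS)
  (expectation_linear_functional a Z0 ZS)
  (expectation_linear_functional_sqr a Z0 ZS).
by exists s => // B mB; rewrite -m0; exact: ms.
Qed.

End linear_form.

Lemma dual_estimator_concentration (R : realType) (d : measure_display)
    (T : measurableType d) (P : probability T R) (N K : nat)
    (Sigma : 'M[R]_N) (Z : 'I_K -> {RV P >-> N.-tuple R}) (a : 'cV[R]_N)
    (w : R) :
  (forall i, gaussian_vector (Z i)) ->
  (forall i, mean_zero (Z i)) ->
  (forall i, has_covariance (Z i) Sigma) ->
  independent_vectors Z ->
  (3 <= K)%N -> Num.sqrt (expR 1) < w ->
  (P [set t | ~~ (w^-1 * rms (fun i => linear_form a (Z i t))
                  <= mxnorm Sigma a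
                  <= w * rms (fun i => linear_form a (Z i t)))%R]
   <= ((Num.sqrt (expR 1) / w) ^+ K)%:E)%E.
Proof.
move=> gZ Z0 ZS indZ K3 hw.
(* The parameters chosen for different samples may differ in sign; only their squares agree. *)
have /choice[s sP] : forall i, exists s : R,
    s ^+ 2 = (a^T *m Sigma *m a) 0 0 /\ (forall B, measurable B ->
      P (linear_form_RV a (Z i) @^-1` B) = gaussian_law 0 s B).
  move=> i.
  have [s s2 sE] := gaussian_vector_linear_form a (gZ i) (Z0 i) (ZS i).
  by exists s.
exact: (gaussian_rms_concentration (independent_linear_forms a indZ)
  (fun i => (sP i).2) (fun i => (sP i).1)).
Qed.

(** * Union bound over the grid and passage to the fast estimators *)

(** [G] is covered by [A] and a null set containing all points where [Q] fails. With [Q] the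
    nonvanishing of the denominators, this discards the samples at which the ratios are default
    values. *)
Lemma le_probability_ae (d : measure_display) (T : measurableType d)
    (R : realType) (P : probability T R) (G A : set T) (Q : T -> Prop) :
  measurable G -> measurable A -> {ae P, forall t, Q t} ->
  (forall t, Q t -> G t -> A t) -> (P G <= P A)%E.
Proof.
move=> mG mA [N0 [mN PN QN]] QGA.
rewrite -[leRHS]adde0 -PN; apply: le_trans (measureU2 P mA mN).
apply: le_measure; rewrite ?inE//; first exact: measurableU.
move=> t Gt; have [Qt|nQt] := pselect (Q t); first by left; exact: QGA.
by right; exact: QN.
Qed.

Theorem proposition4p1 (R : realType) (d : measure_display)
    (Omega : measurableType d) (P : probability Omega R)
    (p N K M L : nat) (Pi : 'I_p -> {fset R})
    (A : grid Pi -> 'M[R]_N) (f u ut : grid Pi -> 'cV[R]_N)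
    (Sigma : 'M[R]_N) (Z : 'I_K -> {RV P >-> N.-tuple R})
    (Y Yt : Omega -> grid Pi -> 'M[R]_(N, K)) (delta w : R) :
  (0 < #|grid Pi|)%N ->
  (forall mu, A mu \in unitmx) ->
  (forall mu, A mu *m u mu = f mu) ->
  separated_form M ut ->
  sympsd Sigma ->
  (forall i, gaussian_vector (Z i)) ->
  (forall i, mean_zero (Z i)) ->
  (forall i, has_covariance (Z i) Sigma) ->
  independent_vectors Z ->
  (forall omega mu i, (A mu)^T *m col i (Y omega mu) = colvec (Z i omega)) ->
  (forall omega, separated_form L (Yt omega)) ->
  (forall mu j i, measurable_fun [set: Omega] (fun omega => Yt omega mu j i)) ->
  0 < delta < 1 ->
  Num.sqrt (expR 1) < w ->
  Num.max ((ln (#|grid Pi|%:R) + ln delta^-1) / ln (w / Num.sqrt (expR 1))) 3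
    <= K%:R ->
  let r mu := f mu - A mu *m ut mu in
  let err mu := mxnorm Sigma (u mu - ut mu) in
  let Delta omega mu := estimator (Y omega mu) (r mu) in
  let Deltat omega mu := estimator (Yt omega mu) (r mu) in
  let Delta2 omega := rms (Delta omega) in
  let Deltat2 omega := rms (Deltat omega) in
  let alphaoo omega := max_ratios (Delta omega) (Deltat omega) in
  let alpha2 omega := max_ratio (Delta2 omega) (Deltat2 omega) in
  ({ae P, forall omega, forall mu, Delta omega mu != 0 /\ Deltat omega mu != 0} ->
    {ae P, forall omega, 1 <= alphaoo omega} /\
    ((1 - delta)%:E <= P [set omega | (forall mu,
      (alphaoo omega * w)^-1 * Deltat omega mu <= err mu
        <= (alphaoo omega * w) * Deltat omega mu)%R])%E) /\
  ({ae P, forall omega, Delta2 omega != 0 /\ Deltat2 omega != 0} ->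
    {ae P, forall omega, 1 <= alpha2 omega} /\
    ((1 - delta)%:E <= P [set omega |
      ((alpha2 omega * w)^-1 * Deltat2 omega <= rms err
        <= (alpha2 omega * w) * Deltat2 omega)%R])%E).
Proof.
move=> n0 Aunit Au _ _ gZ Z0 ZS indZ YZ _ mYt /andP[d0 d1] hw hK r err Delta
  Deltat Delta2 Deltat2 alphaoo alpha2.
have /andP[hKln hK3] : ((ln #|grid Pi|%:R + ln delta^-1)
    / ln (w / Num.sqrt (expR 1)) <= K%:R) && ((3 : R) <= K%:R).
  by rewrite -ge_max.
have K3 : (3 <= K)%N by rewrite -(ler_nat R).
have w0 : 0 < w by apply: lt_trans hw; rewrite sqrtr_gt0 expR_gt0.
have DeltaE omega mu :
    Delta omega mu = rms (fun i => linear_form (u mu - ut mu) (Z i omega)).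
  exact: (estimator_dual (ut mu) (Au mu) (YZ omega mu)).
have mDelta mu : measurable_fun [set: Omega] (Delta ^~ mu).
  under eq_fun do rewrite DeltaE.
  apply: (@measurable_rms _ _ _ _ (fun i t => linear_form _ (Z i t))) => i.
  exact: (measurableT_comp (measurable_linear_form _)).
have mDeltat mu : measurable_fun [set: Omega] (Deltat ^~ mu).
  apply: (@measurable_rms _ _ _ _
    (fun i t => ((col i (Yt t mu))^T *m r mu) 0 0)) => i.
  under eq_fun do rewrite mxE.
  apply: measurable_sum => j; apply: measurable_funM => //.
  by under eq_fun do rewrite !mxE; exact: mYt.
have mDelta2 : measurable_fun [set: Omega] Delta2.
  exact: (@measurable_rms _ _ _ _ (fun mu t => Delta t mu)).
have mDeltat2 : measurable_fun [set: Omega] Deltat2.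
  exact: (@measurable_rms _ _ _ _ (fun mu t => Deltat t mu)).
have Delta0 omega mu : 0 <= Delta omega mu by exact: rms_ge0.
have Deltat0 omega mu : 0 <= Deltat omega mu by exact: rms_ge0.
pose good mu :=
  [set omega | w^-1 * Delta omega mu <= err mu <= w * Delta omega mu].
have mgood mu : measurable (good mu).
  by apply: measurable_le_le => //; exact: measurable_funM.
(* Both conclusions are deduced from this single event, which concerns the exact estimator at all
   parameters simultaneously. *)
pose G := \bigcap_mu good mu.
have mG : measurable G by apply: fin_bigcap_measurable.
have PG : ((1 - delta)%:E <= P G)%E.
  suff : (P (~` G) <= delta%:E)%E.
    rewrite probability_setC// -[P G]fineK ?fin_num_measure//.
    by rewrite -EFinB !lee_fin; lra.
  have PGC : (P (~` G) <= \sum_mu P (~` good mu))%E.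
    apply: (@measure_fin_subadditive _ _ _ _ _ (fun mu => ~` good mu)).
    - by move=> mu; exact: measurableC.
    - exact: measurableC.
    - by rewrite /G setC_bigcap.
  apply: (le_trans PGC).
  apply: (@le_trans _ _
      (\sum_(mu : grid Pi) ((Num.sqrt (expR 1) / w) ^+ K)%:E)%E).
    apply: lee_sum => mu _.
    have := dual_estimator_concentration (u mu - ut mu) gZ Z0 ZS indZ K3 hw.
    apply: le_trans; rewrite le_eqVlt; apply/orP; left; apply/eqP; congr (P _).
    by apply/seteqP; split => t; rewrite /good /= DeltaE => /negP.
  rewrite sumEFin lee_fin sumr_const -[leLHS]mulr_natl.
  exact: sample_size_bound.
split=> nz; split.
- apply: filterS nz => omega nz.
  (* One grid point suffices: the maximum dominates its [max_ratio], the larger of two positive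
     reciprocal numbers. *)
  have /card_gt0P[mu _] := n0; have [D0 Dt0] := nz mu.
  apply: (le_trans _ (le_max_ratios _ _ mu)); apply: max_ratio_ge1;
    by rewrite lt_neqAle eq_sym ?D0 ?Dt0 /=.
- apply: le_trans PG _; apply: le_probability_ae nz _ => //.
    (* Measurability: the quantifier over the finite grid becomes a finite intersection. *)
    rewrite (_ : [set _ | _] = \bigcap_mu [set omega |
        (alphaoo omega * w)^-1 * Deltat omega mu <= err mu
        <= (alphaoo omega * w) * Deltat omega mu]); last first.
      by apply/seteqP; split => t h mu => [_|]; exact: h.
    apply: fin_bigcap_measurable => // mu _.
    have malpha : measurable_fun [set: Omega] alphaoo.
      exact: measurable_max_ratios.
    apply: measurable_le_le => //.
      apply: measurable_funM => //; apply: measurable_invr.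
      exact: measurable_funM.
    by apply: measurable_funM => //; exact: measurable_funM.
  move=> omega nz Gomega mu /=; have [D0 Dt0] := nz mu.
  have D0' : 0 < Delta omega mu by rewrite lt_neqAle eq_sym D0 /=.
  have Dt0' : 0 < Deltat omega mu by rewrite lt_neqAle eq_sym Dt0 /=.
  have le_alpha := le_max_ratios (Delta omega) (Deltat omega) mu.
  apply: le_le_transfer (Gomega mu I) => //.
  + apply: lt_le_trans le_alpha.
    exact: lt_le_trans ltr01 (max_ratio_ge1 D0' Dt0').
  + by apply: le_trans (ler_max_ratiol _ Dt0') _; rewrite ler_pM2r.
  + by apply: le_trans (ler_max_ratior _ D0') _; rewrite ler_pM2r.
- apply: filterS nz => omega [D0 Dt0].
  by apply: max_ratio_ge1; rewrite lt_neqAle eq_sym ?D0 ?Dt0 /= rms_ge0.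
- apply: le_trans PG _; apply: le_probability_ae nz _ => //.
    have malpha : measurable_fun [set: Omega] alpha2.
      exact: measurable_max_ratio.
    apply: measurable_le_le => //.
      apply: measurable_funM => //; apply: measurable_invr.
      exact: measurable_funM.
    by apply: measurable_funM => //; exact: measurable_funM.
  move=> omega [D0 Dt0] Gomega /=.
  have D0' : 0 < Delta2 omega by rewrite lt_neqAle eq_sym D0 /= rms_ge0.
  have Dt0' : 0 < Deltat2 omega by rewrite lt_neqAle eq_sym Dt0 /= rms_ge0.
  apply: (@le_le_transfer _ _ _ (Delta2 omega)) => //.
  + exact: lt_le_trans ltr01 (max_ratio_ge1 D0' Dt0').
  + exact: ler_max_ratiol.
  + exact: ler_max_ratior.
  (* On [G] the bounds hold at every [mu], so squaring and averaging carries them over to the root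
     mean squares; the event [G] serves here without a new tail estimate. *)
  + apply/andP; split.
      rewrite ler_pdivrMl//; apply: rms_le; first exact: ltW.
      move=> mu; rewrite Delta0 -ler_pdivrMl//.
      by have /andP[] := Gomega mu I.
    apply: rms_le; first exact: ltW.
    move=> mu; rewrite sqrtr_ge0.
    by have /andP[] := Gomega mu I.
Qed.
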